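(* Let $X$ be a set. A topological subgroup $G$ of $\mathrm{Sym}(X)$ is skew-amenable if and only if, for every $n \in \mathbb{N}$ and every $x \in X^{n}$, there exists a $G$-invariant mean on $\ell^{\infty}(Gx)$.
   Context: For a topological group $G$ and $g\in G$ let $\lambda_g\colon G\to G,\ x\mapsto gx$. Let $\mathrm{LUCB}(G)$ be the algebra of all bounded functions $f\colon G\to\mathbb{R}$ that are left-uniformly continuous, i.e., for every $\epsilon>0$ there is a neighborhood $U$ of the neutral element with $|f(x)-f(y)|\le\epsilon$ whenever $x,y \in G$ and $x^{-1}y\in U$. A mean on a linear subspace $A\subseteq\ell^\infty(Z)$ containing the constant function $\mathbf 1$ ($Z$ a set, $\ell^\infty(Z)$ the bounded real-valued functions) is a positive linear functional $\mu\colon A\to\mathbb{R}$ with $\mu(\mathbf 1)=1$. The group $G$ is skew-amenable if $\mathrm{LUCB}(G)$ admits a left-invariant mean, i.e., a mean $\mu$ with $\mu(f\circ\lambda_g)=\mu(f)$ for all $f\in\mathrm{LUCB}(G)$, $g\in G$. $\mathrm{Sym}(X)$ is the group of all permutations of $X$ with the topology of pointwise convergence associated with the discrete topology on $X$ (pointwise stabilizers of finite subsets form a neighborhood basis of the identity); a topological subgroup is a subgroup with the subspace topology. $G$ acts on $X^n$ coordinatewise and $Gx=\{gx\mid g\in G\}\subseteq X^n$. A mean $\mu$ on $\ell^\infty(Gx)$ is $G$-invariant if $\mu(f\circ\alpha_g)=\mu(f)$ for all $f\in\ell^\infty(Gx)$ and $g\in G$, where $\alpha_g(y)=gy$. *)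

(* Defs.v *)
From HB Require Import structures.
From mathcomp Require Import all_boot all_order all_algebra.
From mathcomp Require Import monoid all_classical all_reals topology normedtype.

Set Implicit Arguments.
Unset Strict Implicit.
Unset Printing Implicit Defensive.

Import Order.TTheory GRing.Theory Num.Theory.
Import numFieldNormedType.Exports.

Local Open Scope classical_set_scope.
Local Open Scope ring_scope.

HB.mixin Record isTopologicalGroup G of monoid.Group G & Topological G := {
  mulg_continuous : continuous (fun p : G * G => (p.1 * p.2)%g) ;
  invg_continuous : continuous (fun x : G => (x^-1)%g)
}.

#[short(type="topologicalGroupType")]
HB.structure Definition TopologicalGroup :=
  {G of monoid.Group G & Topological G & isTopologicalGroup G}.

Definition lmulg (G : groupType) (g : G) : G -> G := fun x => (g * x)%g.

Record subgroup (gT : groupType) := Subgroup {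
  subgroup_set :> set gT ;
  subgroup_closed : group_closed (mem subgroup_set)
}.

Definition subgroup_type (gT : groupType) (H : subgroup gT) : Type :=
  set_type (subgroup_set H).

Section SubgroupType.

HB.instance Definition _ (gT : groupType) (H : subgroup gT) :=
  SubChoice.on (subgroup_type H).

Lemma subgroup_type_closed (gT : groupType) (H : subgroup gT) :
  group_closed (fun x : gT => x \in subgroup_set H).
Proof. exact: subgroup_closed. Qed.

HB.instance Definition _ (gT : groupType) (H : subgroup gT) :=
  SubChoice_isSubGroup.Build gT _ (subgroup_type H) (subgroup_type_closed H).

(* The subspace topology, i.e. the initial topology for the inclusion. *)
HB.instance Definition _ (gT : topologicalGroupType) (H : subgroup gT) :=
  Topological.copy (subgroup_type H) (set_type (subgroup_set H)).

Lemma continuous_to_subgroup (gT : topologicalGroupType) (H : subgroup gT)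
    (T : topologicalType) (f : T -> subgroup_type H) :
  continuous (fun t => \val (f t) : gT) -> continuous f.
Proof. by move=> cf; apply: (@continuous_comp_initial _ _ _ set_val). Qed.

Lemma continuous_subgroup_val (gT : topologicalGroupType) (H : subgroup gT) :
  continuous (fun x : subgroup_type H => \val x : gT).
Proof. exact: (@initial_continuous _ _ set_val). Qed.

Lemma subgroup_mulg_continuous (gT : topologicalGroupType) (H : subgroup gT) :
  continuous (fun p : subgroup_type H * subgroup_type H => (p.1 * p.2)%g).
Proof.
apply: continuous_to_subgroup => -[x y] /=.
apply: (@continuous2_cvg _ _ _ _ _ _ (fun p : subgroup_type H * subgroup_type H
  => \val p.1) (fun p => \val p.2) (fun a b => (a * b)%g)).
- exact: (@mulg_continuous gT (\val x, \val y)).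
- apply: (@continuous_comp _ _ _ (@fst _ _) (fun z : subgroup_type H => \val z)).
    exact: cvg_fst.
  exact: continuous_subgroup_val.
- apply: (@continuous_comp _ _ _ (@snd _ _) (fun z : subgroup_type H => \val z)).
    exact: cvg_snd.
  exact: continuous_subgroup_val.
Qed.

Lemma subgroup_invg_continuous (gT : topologicalGroupType) (H : subgroup gT) :
  continuous (fun x : subgroup_type H => (x^-1)%g).
Proof.
apply: continuous_to_subgroup => x.
apply: (@continuous_comp _ _ _ (fun z : subgroup_type H => \val z)
  (fun z : gT => z^-1)%g).
  exact: continuous_subgroup_val.
exact: invg_continuous.
Qed.

HB.instance Definition _ (gT : topologicalGroupType) (H : subgroup gT) :=
  isTopologicalGroup.Build (subgroup_type H)
    (@subgroup_mulg_continuous gT H) (@subgroup_invg_continuous gT H).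

End SubgroupType.

(* [{classic X}] is [X] with the choice structure that the library requires of
   the points of a topological space; it allows [X] to be an arbitrary type. *)
Definition sym_set (X : Type) :
    set {ptws X -> discrete_topology {classic X}} :=
  [set f | bijective (f : X -> X)].

Definition sym (X : Type) : Type := set_type (@sym_set X).

Definition sym_fun (X : Type) (g : sym X) : X -> X := \val g.
Coercion sym_fun : sym >-> Funclass.

Section Sym.
Variable X : Type.
Implicit Types g h : sym X.
Let DX := discrete_topology {classic X}.

HB.instance Definition _ := Topological.copy (sym X) (set_type (@sym_set X)).

Lemma sym_bij g : bijective (g : X -> X).
Proof. exact: (set_mem (valP g)). Qed.

Lemma sym_eq g h : (forall x, g x = h x) -> g = h.
Proof. by move=> gh; apply: val_inj; apply/funext => x; exact: gh. Qed.

Definition mk_sym (f : X -> X) (bf : bijective f) : sym X :=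
  exist _ f (mem_set (bf : @sym_set X f)).

Lemma sym_inv_ex g : exists f : X -> X, cancel g f /\ cancel f g.
Proof. by case: (sym_bij g) => f gf fg; exists f. Qed.

Definition sym_inv_fun g : X -> X := projT1 (cid (sym_inv_ex g)).

Lemma sym_invK g : cancel g (sym_inv_fun g).
Proof. by rewrite /sym_inv_fun; case: cid => f []. Qed.

Lemma sym_Kinv g : cancel (sym_inv_fun g) g.
Proof. by rewrite /sym_inv_fun; case: cid => f []. Qed.

Definition sym_one : sym X := mk_sym (Bijective (fun _ => erefl) (fun _ => erefl)
  : bijective (@id X)).
Definition sym_mul g h : sym X := mk_sym (bij_comp (sym_bij g) (sym_bij h)).
Definition sym_inv g : sym X :=
  mk_sym (Bijective (sym_Kinv g) (sym_invK g)).

Lemma sym_mulA : associative sym_mul.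
Proof. by move=> f g h; apply: sym_eq. Qed.
Lemma sym_mul1 : left_id sym_one sym_mul.
Proof. by move=> g; apply: sym_eq. Qed.
Lemma sym_mulr1 : right_id sym_one sym_mul.
Proof. by move=> g; apply: sym_eq. Qed.
Lemma sym_mulV : left_inverse sym_one sym_inv sym_mul.
Proof. by move=> g; apply: sym_eq => x; exact: sym_invK. Qed.
Lemma sym_mulrV : right_inverse sym_one sym_inv sym_mul.
Proof. by move=> g; apply: sym_eq => x; exact: sym_Kinv. Qed.

HB.instance Definition _ := isGroup.Build (sym X)
  sym_mulA sym_mul1 sym_mulr1 sym_mulV sym_mulrV.

(* The product is [g \o h], so that [sym X] acts on [X] from the left. *)
Lemma sym_mulE g h x : (g * h : sym X)%g x = g (h x). Proof. by []. Qed.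
Lemma sym_oneE x : (1%g : sym X) x = x. Proof. by []. Qed.
Lemma sym_invgK g : cancel g (g^-1 : sym X)%g. Proof. exact: sym_invK. Qed.
Lemma sym_invgKV g : cancel (g^-1 : sym X)%g g. Proof. exact: sym_Kinv. Qed.

Lemma sym_near_eq g x : \forall h \near (g : sym X), (h : sym X) x = g x.
Proof.
have c : (fun h : sym X =>
    \val h : {ptws X -> discrete_topology {classic X}}) @ g --> \val g.
  exact: (@initial_continuous _ _ set_val).
have FF : Filter ((fun h : sym X =>
    \val h : {ptws X -> discrete_topology {classic X}}) @ g).
  by apply: (@fmap_filter _ _ _ (nbhs g) (nbhs_filter (g : sym X))).
apply: (((@pointwise_cvgP DX DX _ _ FF).1 c) x [set y | y = g x]).
by rewrite nbhs_principalE; exact/principal_filterP.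
Qed.

Lemma continuous_to_sym (T : topologicalType) (f : T -> sym X) :
  (forall t x, \forall u \near t, f u x = f t x) -> continuous f.
Proof.
move=> H; apply: (@continuous_comp_initial _ _ _ set_val) => t.
apply/(@pointwise_cvgP DX (discrete_topology {classic X})) => x A.
rewrite {1}nbhs_principalE => /principal_filterP Ax.
have : \forall u \near t, A (f u x).
  by apply: filterS (H t x) => u; rewrite /sym_fun => ->.
exact.
Qed.

Lemma sym_mulg_continuous :
  continuous (fun p : sym X * sym X => (p.1 * p.2)%g).
Proof.
apply: continuous_to_sym => -[g h] x.
exists ([set g' : sym X |
    g' ((h : sym X) x) = (g : sym X) ((h : sym X) x)], [set h' : sym X | h' x = (h : sym X) x]).
  by split; exact: sym_near_eq.
by move=> [g' h'] /= [Hg Hh]; rewrite !sym_mulE Hh.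
Qed.

Lemma sym_invg_continuous : continuous (fun g : sym X => (g^-1)%g).
Proof.
apply: continuous_to_sym => g x.
apply: filterS (sym_near_eq g ((g^-1 : sym X)%g x)) => h hg.
by apply: (can_inj (sym_invgK h)); rewrite hg !sym_invgKV.
Qed.

HB.instance Definition _ := isTopologicalGroup.Build (sym X)
  sym_mulg_continuous sym_invg_continuous.

End Sym.

Section Means.
Variable R : realType.

Definition linfty (Z : Type) : set (Z -> R) :=
  [set f | bounded_fun (f : Z -> R^o)].
Arguments linfty : clear implicits.

(* A functional on [A] is represented by a function on all of [Z -> R], whose
   values outside [A] are irrelevant: every condition is restricted to [A]. *)
Definition is_mean (Z : Type) (A : set (Z -> R)) (mu : (Z -> R) -> R) : Prop :=
  [/\ forall (a : R) (f g : Z -> R), A f -> A g ->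
        mu (fun z => a * f z + g z) = a * mu f + mu g,
      forall f : Z -> R, A f -> (forall z, 0 <= f z) -> 0 <= mu f
    & mu (fun=> 1) = 1].

Definition left_uniformly_continuous (G : topologicalGroupType) (f : G -> R) :=
  forall eps : R, 0 < eps ->
    exists2 U : set G, nbhs (1%g : G) U &
      forall x y : G, U (x^-1 * y)%g -> `|f x - f y| <= eps.

Definition LUCB (G : topologicalGroupType) : set (G -> R) :=
  [set f | linfty G f /\ left_uniformly_continuous f].

Definition skew_amenable (G : topologicalGroupType) : Prop :=
  exists mu : (G -> R) -> R, is_mean (@LUCB G) mu /\
    forall (f : G -> R) (g : G), LUCB f -> mu (f \o lmulg g) = mu f.

Definition invariant_mean_on_linfty (G Z : Type) (act : G -> Z -> Z)
    (mu : (Z -> R) -> R) : Prop :=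
  is_mean (linfty Z) mu /\
  forall (f : Z -> R) (g : G), linfty Z f -> mu (f \o act g) = mu f.

(* [linfty Z] and [LUCB G] are linear subspaces containing the constants, and
   [LUCB G] is stable under left translations, as [is_mean] and
   [skew_amenable] presuppose. *)
Lemma linfty_cst (Z : Type) (c : R) : linfty Z (fun=> c).
Proof.
rewrite /linfty /= /bounded_near; near=> M => z _ /=.
by near: M; apply: nbhs_pinfty_ge; exact: num_real.
Unshelve. all: by end_near. Qed.

Lemma linftyP (Z : Type) (f : Z -> R) :
  linfty Z f <-> exists M, forall z, `|f z| <= M.
Proof.
split=> [[M [_ HM]]|[M HM]].
  by exists (M + 1) => z; apply: (HM (M + 1)) => //; rewrite ltrDl.
rewrite /linfty /= /bounded_near; near=> N => z _ /=.
rewrite (le_trans (HM z))//.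
by near: N; apply: nbhs_pinfty_ge; exact: num_real.
Unshelve. all: by end_near. Qed.

Lemma linfty_linear (Z : Type) (a : R) (f g : Z -> R) :
  linfty Z f -> linfty Z g -> linfty Z (fun z => a * f z + g z).
Proof.
move=> /linftyP[M HM] /linftyP[N HN]; apply/linftyP; exists (`|a| * M + N) => z.
by rewrite (le_trans (ler_normD _ _))// lerD// normrM ler_wpM2l.
Qed.

Lemma LUCB_cst (G : topologicalGroupType) (c : R) : @LUCB G (fun=> c).
Proof.
split; first exact: linfty_cst.
move=> e e0; exists setT; first exact: filterT.
by move=> x y _; rewrite subrr normr0 ltW.
Qed.

Lemma LUCB_linear (G : topologicalGroupType) (a : R) (f g : G -> R) :
  LUCB f -> LUCB g -> LUCB (fun z => a * f z + g z).
Proof.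
move=> [bf uf] [bg ug]; split; first exact: linfty_linear.
move=> e e0.
have d0 : 0 < e / 2 / (`|a| + 1) by rewrite !divr_gt0// ltr_wpDl.
have [U U1 HU] := uf _ d0.
have [V V1 HV] := ug (e / 2) (divr_gt0 e0 (ltr0Sn _ _)).
exists (U `&` V); first exact: filterI.
move=> x y [/HU Hf /HV Hg].
rewrite opprD addrACA -mulrBr (le_trans (ler_normD _ _))// [leRHS]splitr lerD//.
rewrite normrM (le_trans (ler_wpM2l (normr_ge0 a) Hf))//.
rewrite mulrCA ler_piMr ?divr_ge0 ?(ltW e0)//.
by rewrite ler_pdivrMr ?ltr_wpDl// mul1r lerDl.
Qed.

Lemma LUCB_lmulg (G : topologicalGroupType) (f : G -> R) (g : G) :
  LUCB f -> LUCB (f \o lmulg g).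
Proof.
move=> [/linftyP[M HM] uf]; split; first by apply/linftyP; exists M => z; exact: HM.
move=> e /uf[U U1 HU]; exists U => // x y Uxy; apply: HU.
by rewrite /lmulg invgM -mulgA mulKg.
Qed.

End Means.

Arguments linfty R Z : clear implicits.

Section TupleOrbit.
Variables (X : Type) (G : subgroup (sym X)) (n : nat).

Definition tuple_act (g : sym X) (x : n.-tuple X) : n.-tuple X :=
  [tuple of map g x].

Definition tuple_orbit (x : n.-tuple X) : set (n.-tuple X) :=
  [set tuple_act g x | g in subgroup_set G].

Lemma tuple_orbit_act (x : n.-tuple X) (g : subgroup_type G)
    (y : tuple_orbit x) : tuple_orbit x (tuple_act (\val g) (\val y)).
Proof.
have [h Gh hy] := set_mem (valP y).
exists (\val g * h)%g; last first.
  by apply: val_inj; rewrite /= -hy /= -map_comp.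
apply: set_mem.
by apply: (group_closedM (subgroup_closed G)); [exact: (valP g)|exact: mem_set].
Qed.

Definition orbit_act (x : n.-tuple X) (g : subgroup_type G)
    (y : tuple_orbit x) : tuple_orbit x :=
  exist _ (tuple_act (\val g) (\val y)) (mem_set (tuple_orbit_act g y)).

End TupleOrbit.

(* Main.v *)
Require Import Defs.
From mathcomp Require Import all_boot all_order all_algebra.
From mathcomp Require Import all_classical all_reals topology normedtype.

(** A basic neighbourhood of the identity in [G] is the stabilizer of a finite
sequence [x] of points, and two group elements lie in the same left coset of
it exactly when they agree on [x].  So the functions [g |-> f (g x)], with [f]
bounded on the orbit [Gx], are left-uniformly continuous, and conversely every
left-uniformly continuous function is, up to any given error, constant on the
fibres of some orbit map [g |-> g x].

An invariant mean on LUCB(G) can therefore be pushed forward along each orbit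
map, which is equivariant; this is [skew_amenable_orbit_mean].

For the converse, an invariant mean on the orbit of [x] is pulled back along a
section of the orbit map to a mean [nu x] on all bounded functions on [G].
A section [s] need not be equivariant, but [g * s y] and [s (g y)] always have the same
image in the orbit.  Hence [nu x] is invariant up to [c] on each function that
varies by at most [c] on the fibres of the orbit map ([orbit_mean_lift]).
Larger tuples [x] have smaller fibres, so a limit of the means [nu x] along an
ultrafilter that contains every tail of the directed family of finite
sequences is exactly invariant on LUCB(G)
([orbit_means_skew_amenable]). *)

Set Implicit Arguments.
Unset Strict Implicit.
Unset Printing Implicit Defensive.

Import Order.TTheory GRing.Theory Num.Theory.
Import numFieldNormedType.Exports.

Local Open Scope classical_set_scope.
Local Open Scope ring_scope.

(** * Means and their ultralimits *)

Section MeanTheory.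
Variable R : realType.

Lemma linfty_comp (Z W : Type) (s : Z -> W) (f : W -> R) :
  linfty R W f -> linfty R Z (f \o s).
Proof. by move=> /linftyP[M fM]; apply/linftyP; exists M => z; exact: fM. Qed.

(** Used for push-forward along orbit maps, for pull-back along sections of
them, and, with [s] the identity, for restriction to a smaller space. *)
Lemma mean_comp (Z W : Type) (A : set (Z -> R)) (B : set (W -> R))
    (s : Z -> W) (mu : (Z -> R) -> R) :
  (forall f, B f -> A (f \o s)) ->
  is_mean A mu -> is_mean B (fun f => mu (f \o s)).
Proof.
move=> BA [lin pos one]; split=> // [a f g Bf Bg|f Bf f0].
  by rewrite -lin//; exact: BA.
by apply: pos => [|z]; [exact: BA|exact: f0].
Qed.

Section MeanOnLinfty.
Variables (Z : Type) (mu : (Z -> R) -> R).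
Hypothesis mean_mu : is_mean (linfty R Z) mu.

Lemma mean_cst (c : R) : mu (fun=> c) = c.
Proof.
have [lin _ one] := mean_mu.
have mu0 : mu (fun=> 0) = 0.
  have := lin 1 _ _ (linfty_cst Z 0) (linfty_cst Z 0).
  rewrite mulr0 addr0 mul1r => /eqP.
  by rewrite -subr_eq0 opprD addrA subrr sub0r oppr_eq0 => /eqP.
have := lin c _ _ (linfty_cst Z 1) (linfty_cst Z 0).
by rewrite mulr1 addr0 one mu0 mulr1 addr0.
Qed.

Lemma mean_le (f g : Z -> R) : linfty R Z f -> linfty R Z g ->
  (forall z, f z <= g z) -> mu f <= mu g.
Proof.
move=> bf bg fg; have [lin pos _] := mean_mu.
have := pos _ (linfty_linear (-1) bf bg).
rewrite lin// mulN1r addrC subr_ge0; apply => z.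
by rewrite mulN1r addrC subr_ge0.
Qed.

Lemma mean_dist_le (f g : Z -> R) (c : R) : linfty R Z f -> linfty R Z g ->
  (forall z, `|f z - g z| <= c) -> `|mu f - mu g| <= c.
Proof.
have [lin _ _] := mean_mu.
have le_half (u v : Z -> R) : linfty R Z u -> linfty R Z v ->
    (forall z, u z - v z <= c) -> mu u - mu v <= c.
  move=> bu bv uv; have bc := linfty_cst Z c.
  rewrite lerBlDl -[X in _ + X](mean_cst c) -[mu v]mul1r -lin//.
  apply: mean_le => // [|z]; first exact: linfty_linear.
  by rewrite mul1r -lerBlDl.
move=> bf bg fg; rewrite ler_norml; apply/andP; split; last first.
  by apply: le_half => // z; exact: le_trans (ler_norm _) (fg z).
rewrite lerNl opprB; apply: le_half => // z.
by rewrite -opprB -lerNl; have := fg z; rewrite ler_norml => /andP[].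
Qed.

End MeanOnLinfty.

(** The image of [F] is an ultrafilter that contains a compact segment, and
such an ultrafilter converges. *)
Lemma bounded_ultrafilter_cvg (I : Type) (F : set_system I) (u : I -> R)
    (M : R) : UltraFilter F -> (forall i, `|u i| <= M) -> cvg (u i @[i --> F]).
Proof.
move=> UF uM.
have uUF : UltraFilter (u @ F).
  split; first exact: fmap_proper_filter.
  move=> H PH sFH; apply/seteqP; split=> // A HA.
  have [//|FnA] := in_ultra_setVsetC (u @^-1` A) UF.
  have HnA : H (~` A) by exact: sFH.
  by have [x []] := filter_ex (filterI HA HnA).
have := @segment_compact R (- M) M; rewrite compact_ultra => /(_ _ uUF)[|l [_ ul]].
  by apply: (@filterE _ F) => i /=; rewrite in_itv/= -ler_norml.
by apply/cvg_ex; exists l.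
Qed.

Section Ultralimit.
Variables (I Z : Type) (F : set_system I) (nu : I -> (Z -> R) -> R).
Hypotheses (UF : UltraFilter F) (mean_nu : forall i, is_mean (linfty R Z) (nu i)).

Definition ultralimit_mean (f : Z -> R) : R := lim (nu i f @[i --> F]).

Lemma ultralimit_mean_cvg (f : Z -> R) :
  linfty R Z f -> nu i f @[i --> F] --> ultralimit_mean f.
Proof.
move=> bf; have /linftyP[M fM] := bf.
rewrite /ultralimit_mean; apply: (@bounded_ultrafilter_cvg _ F _ M) => // i.
rewrite -[nu i f]subr0 -(mean_cst (mean_nu i) 0).
apply: mean_dist_le => // [|z]; first exact: linfty_cst.
by rewrite subr0.
Qed.

Lemma ultralimit_meanP : is_mean (linfty R Z) ultralimit_mean.
Proof.
split=> [a f g bf bg|f bf f0|].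
- apply: cvg_lim => //; under eq_fun => i do
    (have [-> // _ _] := mean_nu i).
  apply: cvgD; last exact: ultralimit_mean_cvg.
  by apply: cvgM; [exact: cvg_cst|exact: ultralimit_mean_cvg].
- apply: (cvgr_to_ge (ultralimit_mean_cvg bf)).
  by apply: filterE => i; have [_ pos _] := mean_nu i; exact: pos.
- apply: cvg_lim => //; under eq_fun => i do
    (have [_ _ ->] := mean_nu i).
  exact: cvg_cst.
Qed.

End Ultralimit.
End MeanTheory.

(** * Neighbourhoods of the identity in a permutation group *)

Lemma cvg_initial (S : choiceType) (T : topologicalType) (f : S -> T)
    (F : set_system S) (s : S) : Filter F ->
  f @ F --> f s -> F --> (s : initial_topology f).
Proof.
move=> FF cf A [_ [[B oB <-] Bs sBA]].
by apply: (filterS sBA); apply: cf; exact: open_nbhs_nbhs.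
Qed.

Lemma eq_map_cat (X Y : Type) (f g : X -> Y) (s t : seq X) :
  map f (s ++ t) = map g (s ++ t) -> map f s = map g s /\ map f t = map g t.
Proof.
rewrite !map_cat => e; split.
  by move/(congr1 (take (size s))): e; rewrite !take_size_cat ?size_map.
by move/(congr1 (drop (size s))): e; rewrite !drop_size_cat ?size_map.
Qed.

Section Orbits.
Variables (X : Type) (G : subgroup (sym X)).
Local Notation GT := (subgroup_type G).

Definition act (g : GT) (x : X) : X := (\val g : sym X) x.

(** Equivalently, the filter generated by the stabilizers converges to the
identity.  This can be tested in the topology of pointwise convergence, of
which the topology of [G] is induced in two steps, and there the stabilizer of
a single point suffices. *)
Lemma nbhs_one_stabilizer (U : set GT) : nbhs (1%g : GT) U ->
  exists s : seq X, forall g : GT, map (act g) s = s -> U g.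
Proof.
pose stab (s : seq X) := [set g : GT | map (act g) s = s].
have FF : Filter (filter_from setT stab).
  apply: filter_from_filter => [|s t _ _]; first by exists [::].
  exists (s ++ t) => // g; rewrite /stab /=.
  by have := @eq_map_cat _ _ (act g) id s t; rewrite !map_id.
suff cF : filter_from setT stab --> (1%g : GT).
  by move=> /cF[s _ sU]; exists s.
apply: (@cvg_initial _ (sym X) (@set_val _ G)).
apply: (@cvg_initial _ _ (@set_val _ (@sym_set X))).
apply/(@pointwise_cvgP (discrete_topology {classic X})
  (discrete_topology {classic X})) => x A.
rewrite {1}nbhs_principalE => /principal_filterP Ax.
exists [:: x] => // g [gx].
by change (A (act g x)); rewrite gx.
Qed.

Lemma near_one_stabilizer (s : seq X) :
  \forall g \near (1%g : GT), map (act g) s = s.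
Proof.
elim: s => [|x s IHs]; first exact: filterE.
have fix_x : \forall g \near (1%g : GT), act g x = x.
  exact: (@continuous_subgroup_val _ G (1%g : GT) _ (sym_near_eq 1%g x)).
by apply: filterS2 fix_x IHs => g /= -> ->.
Qed.

(** * Orbit maps and left-uniform continuity *)

(** Elements of [G] that differ on the right by an element of the stabilizer
of [x] have the same image in the orbit, so a single neighbourhood serves every
[eps]. *)
Lemma LUCB_orbit (R : realType) n (x : n.-tuple X)
    (o : GT -> tuple_orbit G x) :
  (forall g, \val (o g) = tuple_act (\val g) x) ->
  forall f : tuple_orbit G x -> R, linfty R _ f -> LUCB (f \o o).
Proof.
move=> oE f bf; split; first exact: linfty_comp.
move=> e e0; exists [set g : GT | map (act g) x = x].
  exact: near_one_stabilizer.
move=> g h /= gh; suff -> : o g = o h by rewrite subrr normr0 ltW.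
apply: val_inj; rewrite !oE; apply: val_inj => /=.
rewrite -{1}gh -map_comp; apply: eq_map => y /=.
exact: sym_invgKV.
Qed.

(** If [g] and [h] agree on a sequence [s] then [g^-1 * h] stabilizes it. *)
Lemma LUCB_almost_factors (R : realType) (f : GT -> R) (e : R) :
  LUCB f -> 0 < e -> exists s : seq X, forall g h : GT,
    map (act g) s = map (act h) s -> `|f g - f h| <= e.
Proof.
move=> [_ uf] /uf[U /nbhs_one_stabilizer[s sU] Uf].
exists s => g h gh; apply/Uf/sU.
transitivity (map (act (g^-1)%g) (map (act h) s)); first by rewrite -map_comp.
by rewrite -gh -map_comp -[RHS]map_id; apply: eq_map => x; exact: sym_invgK.
Qed.

(** The mean [nu f] is [mu (f \o s)] for a section [s] of the orbit map
[g |-> g x].  Its defect of invariance comes only from the failure of [s] to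
be equivariant, which displaces points within a fibre of the orbit map. *)
Lemma orbit_mean_lift (R : realType) n (x : n.-tuple X)
    (mu : (tuple_orbit G x -> R) -> R) :
  invariant_mean_on_linfty (@orbit_act X G n x) mu ->
  exists2 nu : (GT -> R) -> R, is_mean (linfty R GT) nu &
    forall (f : GT -> R) (g : GT) (c : R), linfty R GT f ->
      (forall h k : GT, map (act h) x = map (act k) x -> `|f h - f k| <= c) ->
      `|nu (f \o lmulg g) - nu f| <= c.
Proof.
move=> [mean_mu inv_mu].
have /choice[s sP] : forall y : tuple_orbit G x,
    exists g : GT, map (act g) x = \val y.
  move=> y; have [g Gg gx] := set_mem (valP y).
  by exists (exist _ g (mem_set Gg)); rewrite -gx.
exists (fun f => mu (f \o s)); first by apply: mean_comp mean_mu => f; exact: linfty_comp.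
move=> f g c bf fc.
(* Translating the second argument turns the claim into a comparison of
   [f (g * s y)] with [f (s (g y))], for each point [y] of the orbit. *)
rewrite -(inv_mu (f \o s) g (linfty_comp s bf)).
apply: mean_dist_le => //; [by do 2!apply: linfty_comp..|].
move=> y; apply: fc; rewrite sP /= -(sP y) -map_comp.
exact: eq_map.
Qed.

(** * The two implications *)

Lemma skew_amenable_orbit_mean (R : realType) n (x : n.-tuple X) :
  skew_amenable R GT ->
  exists mu : (tuple_orbit G x -> R) -> R,
    invariant_mean_on_linfty (@orbit_act X G n x) mu.
Proof.
move=> [mu [mean_mu inv_mu]].
have orb (g : GT) : tuple_orbit G x (tuple_act (\val g) x).
  by exists (\val g) => //; exact: (set_mem (valP g)).
pose o (g : GT) : tuple_orbit G x := exist _ (tuple_act (\val g) x) (mem_set (orb g)).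
have oL := @LUCB_orbit R n x o (fun=> erefl).
exists (fun f => mu (f \o o)); split; first exact: mean_comp mean_mu.
move=> f g bf; rewrite -(inv_mu (f \o o) g (oL _ bf)).
congr mu; apply/funext => h /=; congr f; apply: val_inj => /=.
by apply: val_inj; rewrite /= -map_comp.
Qed.

Lemma orbit_means_skew_amenable (R : realType) :
  (forall (n : nat) (x : n.-tuple X),
     exists mu : (tuple_orbit G x -> R) -> R,
       invariant_mean_on_linfty (@orbit_act X G n x) mu) ->
  skew_amenable R GT.
Proof.
move=> H.
(* The order on sequences compares the partitions of [G] into the fibres of
   the orbit maps; concatenation gives a common refinement. *)
pose tail (s : seq X) := [set t : seq X | forall g h : GT,
  map (act g) t = map (act h) t -> map (act g) s = map (act h) s].
have tailPF : ProperFilter (filter_from setT tail).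
  apply: filter_from_proper => [|s _]; last by exists s.
  apply: filter_from_filter => [|s t _ _]; first by exists [::].
  by exists (s ++ t) => // u ust; split=> g h /ust /eq_map_cat[].
have [F [UF tailF]] := ultraFilterLemma tailPF.
have /choice[nu nuP] : forall s : seq X, exists nu : (GT -> R) -> R,
    is_mean (linfty R GT) nu /\
    forall (f : GT -> R) (g : GT) (c : R), linfty R GT f ->
      (forall h k : GT, map (act h) s = map (act k) s -> `|f h - f k| <= c) ->
      `|nu (f \o lmulg g) - nu f| <= c.
  move=> s; have [mu /orbit_mean_lift[nu ? ?]] := H _ (in_tuple s).
  by exists nu.
have mean_nu s : is_mean (linfty R GT) (nu s) by case: (nuP s).
exists (ultralimit_mean F nu); split.
  exact: (@mean_comp _ _ _ _ (@LUCB R GT) id _ (fun f => @proj1 _ _)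
    (ultralimit_meanP UF mean_nu)).
move=> f g Lf; have [bf _] := Lf; have [bfg _] := LUCB_lmulg g Lf.
have dcvg : `|nu t (f \o lmulg g) - nu t f| @[t --> F] -->
    `|ultralimit_mean F nu (f \o lmulg g) - ultralimit_mean F nu f|.
  by apply: cvg_norm; apply: cvgB; exact: ultralimit_mean_cvg.
apply/eqP; rewrite -subr_eq0 -normr_le0; apply/ler_addgt0Pr => e e0.
rewrite add0r; apply: (cvgr_to_le dcvg).
have [s sf] := LUCB_almost_factors Lf e0.
apply: (filterS _ (tailF (tail s) _)); last by exists s.
move=> t st; have [_ nut] := nuP t.
by apply: nut => // h k /st /sf.
Qed.

End Orbits.

Theorem corollary3p13 (R : realType) (X : Type) (G : subgroup (sym X)) :
  skew_amenable R (subgroup_type G) <->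
  (forall (n : nat) (x : n.-tuple X),
     exists mu : (tuple_orbit G x -> R) -> R,
       invariant_mean_on_linfty (@orbit_act X G n x) mu).
Proof.
split=> [sa n x|]; first exact: skew_amenable_orbit_mean.
exact: orbit_means_skew_amenable.
Qed.
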